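(* Let $\mathcal I_{f_I}$ be the isotropy group of $f_I$ in $\mathrm{Aut}(A_1)\times\mathrm{Aut}(\mathfrak{sl}(2))$. Then $$\mathcal I_{f_I}=\{(\hat\alpha_1(g),\mathrm{Ad}(g)) : g\in SL(2,\mathbb C)\}.$$ In particular, $\mathcal I_{f_I}$ is isomorphic to $SL(2,\mathbb C)$.
   Context: The Weyl algebra $A_1$ is the complex associative unital algebra generated by $p,q$ with $pq-qp=1$, with Lie bracket $[a,b]=ab-ba$. $A_1^{\mathfrak{sl}(2)}$ is the set of injective Lie algebra homomorphisms $\mathfrak{sl}(2)=\mathfrak{sl}(2,\mathbb C)\to A_1$. The group $\mathrm{Aut}(A_1)\times\mathrm{Aut}(\mathfrak{sl}(2))$ acts on it by $(\alpha,w)\cdot f=\alpha\circ f\circ w^{-1}$, and the isotropy group of $f$ is its stabiliser $\{\gamma:\gamma\cdot f=f\}$. Let $e_+=\begin{pmatrix}0&1\\ 0&0\end{pmatrix}$, $e_-=\begin{pmatrix}0&0\\ 1&0\end{pmatrix}$, $e_0=\begin{pmatrix}1&0\\ 0&-1\end{pmatrix}$. The element $f_I\in A_1^{\mathfrak{sl}(2)}$ is defined by $f_I(e_+)=-\frac12q^2$, $f_I(e_-)=\frac12p^2$, $f_I(e_0)=\frac12(pq+qp)$. $\mathrm{Ad}:SL(2,\mathbb C)\to\mathrm{Aut}(\mathfrak{sl}(2))$ is $\mathrm{Ad}(g)(x)=gxg^{-1}$. $\hat\alpha_1:SL(2,\mathbb C)\to\mathrm{Aut}(A_1)$ is the group homomorphism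 sending $g=\begin{pmatrix}a_1&a_2\\ a_3&a_4\end{pmatrix}$ to the automorphism with $\hat\alpha_1(g)(p)=a_2q+a_4p$ and $\hat\alpha_1(g)(q)=a_1q+a_3p$. *)

(* Defs.v *)
From HB Require Import structures.
From mathcomp Require Import all_boot all_order all_algebra.
From mathcomp Require Import finmap boolp classical_sets reals complex monalg ring.

Set Implicit Arguments.
Unset Strict Implicit.
Unset Printing Implicit Defensive.

Import GRing.Theory Num.Theory.
Import Quotient.
Local Open Scope ring_scope.
Local Open Scope quotient_scope.

HB.mixin Record Lmodule_isLie (K : pzRingType) L of GRing.Lmodule K L := {
  lie : L -> L -> L;
  lie_linearl : forall (a : K) (x y z : L),
    lie (a *: x + y) z = a *: lie x z + lie y z;
  lie_linearr : forall (a : K) (x y z : L),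
    lie x (a *: y + z) = a *: lie x y + lie x z;
  liexx : forall x : L, lie x x = 0;
  lie_jacobi : forall x y z : L,
    lie x (lie y z) + lie y (lie z x) + lie z (lie x y) = 0
}.

#[short(type="lieAlgType")]
HB.structure Definition LieAlgebra (K : pzRingType) :=
  {L of Lmodule_isLie K L & GRing.Lmodule K L}.

Definition commutator (A : pzRingType) (a b : A) : A := a * b - b * a.

Lemma rmorph_commutator (A B : pzRingType) (f : {rmorphism A -> B}) (a b : A) :
  f (commutator a b) = commutator (f a) (f b).
Proof. by rewrite /commutator rmorphB !rmorphM. Qed.

Section Commutator.
Variables (K : comNzRingType) (A : algType K).
Implicit Types x y z : A.

Lemma commutator_linearl (a : K) x y z :
  commutator (a *: x + y) z = a *: commutator x z + commutator y z.
Proof.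
rewrite /commutator mulrDl mulrDr -scalerAl -scalerAr scalerBr.
by rewrite opprD addrACA.
Qed.

Lemma commutator_linearr (a : K) x y z :
  commutator x (a *: y + z) = a *: commutator x y + commutator x z.
Proof.
rewrite /commutator mulrDl mulrDr -scalerAl -scalerAr scalerBr.
by rewrite opprD addrACA.
Qed.

Lemma commutatorDl x y z : commutator (x + y) z = commutator x z + commutator y z.
Proof. by rewrite -[x]scale1r commutator_linearl !scale1r. Qed.
Lemma commutatorDr x y z : commutator x (y + z) = commutator x y + commutator x z.
Proof. by rewrite -[y]scale1r commutator_linearr !scale1r. Qed.
Lemma commutatorZl (a : K) x y : commutator (a *: x) y = a *: commutator x y.
Proof. by rewrite /commutator scalerBr -scalerAl -scalerAr. Qed.
Lemma commutatorZr (a : K) x y : commutator x (a *: y) = a *: commutator x y.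
Proof. by rewrite /commutator scalerBr -scalerAl -scalerAr. Qed.

Lemma commutatorNl x y : commutator (- x) y = - commutator x y.
Proof. by rewrite -scaleN1r commutatorZl scaleN1r. Qed.
Lemma commutatorNr x y : commutator x (- y) = - commutator x y.
Proof. by rewrite -scaleN1r commutatorZr scaleN1r. Qed.
Lemma commutator_anti x y : commutator x y = - commutator y x.
Proof. by rewrite /commutator opprB. Qed.
Lemma commutatorMl x y z :
  commutator (x * y) z = x * commutator y z + commutator x z * y.
Proof. by rewrite /commutator mulrBr mulrBl !mulrA addrA subrK. Qed.
Lemma commutatorMr x y z :
  commutator x (y * z) = y * commutator x z + commutator x y * z.
Proof. by rewrite /commutator mulrBr mulrBl !mulrA [RHS]addrC addrA subrK. Qed.

Lemma commutatorxx x : commutator x x = 0.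
Proof. by rewrite /commutator subrr. Qed.

Lemma commutator_jacobi x y z :
  commutator x (commutator y z) + commutator y (commutator z x)
    + commutator z (commutator x y) = 0.
Proof.
have H1 (a b c d : A) : a - b - (c - d) = (a + d) - (b + c).
  by rewrite opprB opprD addrACA.
have H2 (a b c d e f : A) :
    (a - b) + (c - d) + (e - f) = (a + c + e) - (b + d + f).
  by rewrite !opprD (addrACA a) (addrACA (a + c)).
rewrite /commutator !mulrBr !mulrBl !mulrA !H1 H2.
by apply/eqP; rewrite subr_eq0; apply/eqP; rewrite [RHS](AC (2*2*2) ((6*5)*(2*1)*(4*3))).
Qed.
End Commutator.

(* {malg K[{fmonom bool}]} is the algebra of the free monoid on two letters,
   i.e. the free associative unital K-algebra on free_p and free_q. *)
Section WeylIdeal.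
Variable K : fieldType.

Definition free_p : {malg K[{fmonom bool}]} := << fmu true >>.
Definition free_q : {malg K[{fmonom bool}]} := << fmu false >>.

Definition two_sided_ideal (A : nzRingType) (I : set A) : Prop :=
  [/\ I 0, (forall a b, I a -> I b -> I (a - b)) &
      (forall a u b, I u -> I (a * u * b))].

Definition weyl_ideal : {pred {malg K[{fmonom bool}]}} := fun a =>
  `[< forall I : set {malg K[{fmonom bool}]}, two_sided_ideal I ->
        I (commutator free_p free_q - 1) -> I a >].

Lemma weyl_ideal_zmod_closed : zmod_closed weyl_ideal.
Proof.
split; first by apply/asboolP => I [].
move=> a b /asboolP Ia /asboolP Ib; apply/asboolP => I II Irel.
by case: (II) => _ IB _; apply: IB; [apply: Ia | apply: Ib].
Qed.

HB.instance Definition _ :=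
  GRing.isZmodClosed.Build _ weyl_ideal weyl_ideal_zmod_closed.

Lemma weyl_idealM a u b : u \in weyl_ideal -> a * u * b \in weyl_ideal.
Proof.
move=> /asboolP Iu; apply/asboolP => I II Irel.
by case: (II) => _ _; apply; apply: Iu.
Qed.

Lemma weyl_ideal_rel : commutator free_p free_q - 1 \in weyl_ideal.
Proof. by apply/asboolP. Qed.

(* The action of K<p, q> on K[X] with p acting as d/dX and q as multiplication
   by X: it shows that the ideal is proper. *)
Definition word_act (m : {fmonom bool}) (f : {poly K}) : {poly K} :=
  foldr (fun b g => if b then g^`() else 'X * g) f m.

Definition free_act (a : {malg K[{fmonom bool}]}) (f : {poly K}) : {poly K} :=
  mmap polyC (word_act^~ f) a.

Lemma word_act_is_linear m : linear (word_act m).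
Proof.
rewrite /word_act => c f g; elim: (m : seq bool) => //= b s ->.
by case: b; rewrite ?derivD ?derivZ // mulrDr -scalerAr.
Qed.
HB.instance Definition _ m :=
  GRing.isLinear.Build K {poly K} {poly K} _ (word_act m) (word_act_is_linear m).

Lemma free_actU c m f : free_act << c *g m >> f = c *: word_act m f.
Proof. by rewrite /free_act mmapU mul_polyC. Qed.

Lemma free_actB a b f : free_act (a - b) f = free_act a f - free_act b f.
Proof. by rewrite /free_act raddfB. Qed.

Lemma free_actM a b f : free_act (a * b) f = free_act a (free_act b f).
Proof.
rewrite malgME {1}/free_act raddf_sum {2}/free_act mmapE.
apply: eq_bigr => k1 _; rewrite raddf_sum [X in _ * X]raddf_sum mulr_sumr.
apply: eq_bigr => k2 _.
rewrite [LHS]mmapU /= !mul_polyC linearZ /= scalerA.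
by rewrite /word_act fmM foldr_cat.
Qed.

Lemma free_act1 f : free_act 1 f = f.
Proof. by rewrite free_actU scale1r /word_act fm1. Qed.

Lemma free_act_p f : free_act free_p f = f^`().
Proof. by rewrite free_actU scale1r /word_act fmU. Qed.

Lemma free_act_q f : free_act free_q f = 'X * f.
Proof. by rewrite free_actU scale1r /word_act fmU. Qed.

Lemma free_act_ideal a f : a \in weyl_ideal -> free_act a f = 0.
Proof.
move=> /asboolP/(_ [set a | forall f, free_act a f = 0]%classic); apply.
  split=> /=.
  - by move=> g; rewrite /free_act raddf0.
  - by move=> {}a b a0 b0 g; rewrite free_actB a0 b0 subr0.
  - move=> {}a u b u0 g; rewrite !free_actM u0.
    by rewrite /free_act mmapE big1 // => k _; rewrite raddf0 mulr0.
move=> g /=; move: (free_act_p) (free_act_q).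
move: free_p free_q => x y xE yE.
rewrite /commutator.
have H u v w : free_act u g = ('X * g)^`() -> free_act v g = 'X * g^`() ->
    free_act w g = g -> free_act (u - v - w) g = 0.
  move=> uE vE wE; rewrite 2!free_actB uE vE wE.
  by rewrite derivM derivX mul1r addrK subrr.
by apply: H; rewrite ?free_act1 // free_actM xE yE.
Qed.

Lemma weyl_ideal1 : 1 \notin weyl_ideal.
Proof.
apply/negP => /(free_act_ideal 1); rewrite free_act1 => /eqP.
by rewrite oner_eq0.
Qed.

Lemma malgUZ (T : monomType) (R : nzRingType) (c : R) (k : T) :
  << c *g k >> = c *: << k >> :> {malg R[T]}.
Proof. by apply/malgP => k'; rewrite mcoeffZ !mcoeffU mulr_natr. Qed.

Lemma malg_mulZr (c : K) (a b : {malg K[{fmonom bool}]}) :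
  c *: (a * b) = a * (c *: b).
Proof.
have aC : a * c%:MP = c%:MP * a.
  rewrite mul_malgC; apply/malgP => k; rewrite mcoeffZ.
  rewrite (mcoeffMrw (d1 := msupp a) (d2 := [fset mone]%fset)) //=; last first.
    by rewrite /malgC msuppU_le.
  rewrite big_seq_fset1 mcoeffUU.
  have [ka|kNa] := boolP (k \in msupp a).
    rewrite (big_fsetD1 k) //= mulm1 eqxx mulr1n mulrC [X in _ + X]big_seq big1 ?addr0 //.
    by move=> j; rewrite !inE mulm1 => /andP[/negPf -> _]; rewrite mulr0n.
  rewrite (mcoeff_outdom kNa) mulr0 big_seq big1 // => j ja; rewrite mulm1.
  by case: eqP => [jk|]; [rewrite -jk ja in kNa | rewrite mulr0n].
apply: etrans (esym (mul_malgC _ _)) _.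
apply: etrans (mulrA _ _ _) _.
apply: etrans (congr1 ( *%R^~ b) (esym aC)) _.
by apply: etrans (esym (mulrA _ _ _)) _; congr (_ * _); apply: mul_malgC.
Qed.

Lemma two_sided_mulB (A : nzRingType) (I : zmodClosed A) (x x' y y' : A) :
  (forall a u b, u \in I -> a * u * b \in I) ->
  x - x' \in I -> y - y' \in I -> x * y - x' * y' \in I.
Proof.
move=> IM xI yI; have -> : x * y - x' * y' = 1 * (x - x') * y + x' * (y - y') * 1.
  by rewrite mul1r mulr1 mulrBl mulrBr addrA subrK.
by rewrite rpredD // IM.
Qed.

Definition weyl := {quot weyl_ideal}.
HB.instance Definition _ := ZmodQuotient.on weyl.

Definition weyl_one : weyl := lift_cst weyl 1.
Definition weyl_mul := lift_op2 weyl *%R.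
Definition weyl_scale (c : K) := lift_op1 weyl ( *:%R c).

Canonical pi_weyl_one_morph := PiConst weyl_one.

Lemma pi_weyl_mul : {morph \pi : x y / x * y >-> weyl_mul x y}.
Proof.
move=> x y; unlock weyl_mul; apply/eqP; rewrite piE equivE.
apply: two_sided_mulB; first exact: weyl_idealM.
  by rewrite idealrBE reprK.
by rewrite idealrBE reprK.
Qed.
Canonical pi_weyl_mul_morph := PiMorph2 pi_weyl_mul.

Lemma pi_weyl_scale c : {morph \pi : x / c *: x >-> weyl_scale c x}.
Proof.
move=> x; unlock weyl_scale; apply/eqP; rewrite piE equivE.
rewrite -scalerBr -mul_malgC -[_ * _]mulr1 weyl_idealM //.
by rewrite idealrDE opprK reprK.
Qed.
Canonical pi_weyl_scale_morph c := PiMorph1 (pi_weyl_scale c).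

Fact weyl_mulA : associative weyl_mul.
Proof. by move=> x y z; rewrite -[x]reprK -[y]reprK -[z]reprK !piE mulrA. Qed.
Fact weyl_mul1 : left_id weyl_one weyl_mul.
Proof. by move=> x; rewrite -[x]reprK !piE mul1r. Qed.
Fact weyl_mulr1 : right_id weyl_one weyl_mul.
Proof. by move=> x; rewrite -[x]reprK !piE mulr1. Qed.
Fact weyl_mulDl : left_distributive weyl_mul +%R.
Proof.
move=> x y z; rewrite -[x]reprK -[y]reprK -[z]reprK.
by apply/eqP; rewrite piE /= mulrDl equiv_refl.
Qed.
Fact weyl_mulDr : right_distributive weyl_mul +%R.
Proof.
move=> x y z; rewrite -[x]reprK -[y]reprK -[z]reprK.
by apply/eqP; rewrite piE /= mulrDr equiv_refl.
Qed.
Fact weyl_1_neq0 : weyl_one != 0.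
Proof. by rewrite piE equivE subr0 weyl_ideal1. Qed.

HB.instance Definition _ := GRing.Zmodule_isNzRing.Build weyl
  weyl_mulA weyl_mul1 weyl_mulr1 weyl_mulDl weyl_mulDr weyl_1_neq0.

Fact weyl_scaleA a b v : weyl_scale a (weyl_scale b v) = weyl_scale (a * b) v.
Proof. by rewrite -[v]reprK !piE scalerA. Qed.
Fact weyl_scale1 : left_id 1 weyl_scale.
Proof. by move=> v; rewrite -[v]reprK !piE scale1r. Qed.
Fact weyl_scaleDr : right_distributive weyl_scale +%R.
Proof.
move=> c x y; rewrite -[x]reprK -[y]reprK.
by apply/eqP; rewrite piE /= scalerDr equiv_refl.
Qed.
Fact weyl_scaleDl v : {morph weyl_scale^~ v : a b / a + b}.
Proof.
move=> a b; rewrite -[v]reprK.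
by apply/eqP; rewrite piE /= scalerDl equiv_refl.
Qed.

HB.instance Definition _ := GRing.Zmodule_isLmodule.Build K weyl
  weyl_scaleA weyl_scale1 weyl_scaleDr weyl_scaleDl.

Fact weyl_scaleAl (c : K) (x y : weyl) : c *: (x * y) = (c *: x) * y.
Proof.
rewrite -[x]reprK -[y]reprK.
by apply/eqP; rewrite piE /= scalerAl equiv_refl.
Qed.
HB.instance Definition _ := GRing.Lmodule_isLalgebra.Build K weyl weyl_scaleAl.

Fact weyl_scaleAr (c : K) (x y : weyl) : c *: (x * y) = x * (c *: y).
Proof.
rewrite -[x]reprK -[y]reprK.
by apply/eqP; rewrite piE /= malg_mulZr equiv_refl.
Qed.
HB.instance Definition _ := GRing.Lalgebra_isAlgebra.Build K weyl weyl_scaleAr.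

HB.instance Definition _ := Lmodule_isLie.Build K weyl
  (@commutator_linearl K weyl) (@commutator_linearr K weyl)
  (@commutatorxx K weyl) (@commutator_jacobi K weyl).

Lemma pi_weyl1 : \pi_weyl 1 = 1.
Proof. by rewrite -[RHS]/weyl_one !piE. Qed.
Lemma pi_weylM a b : \pi_weyl (a * b) = \pi_weyl a * \pi_weyl b.
Proof. by rewrite !piE. Qed.
Lemma pi_weylD a b : \pi_weyl (a + b) = \pi_weyl a + \pi_weyl b.
Proof. by rewrite !piE. Qed.
Lemma pi_weylZ c a : \pi_weyl (c *: a) = c *: \pi_weyl a.
Proof. exact: pi_weyl_scale. Qed.

(* Sealed: unifying weyl_p with weyl_q by unfolding is very slow. *)
Fact weyl_p_key : unit. Proof. exact: tt. Qed.
Fact weyl_q_key : unit. Proof. exact: tt. Qed.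
Definition weyl_p : weyl := locked_with weyl_p_key (\pi free_p).
Definition weyl_q : weyl := locked_with weyl_q_key (\pi free_q).

Lemma weyl_pE : weyl_p = \pi free_p. Proof. by rewrite /weyl_p unlock. Qed.
Lemma weyl_qE : weyl_q = \pi free_q. Proof. by rewrite /weyl_q unlock. Qed.

Lemma weyl_pq : weyl_p * weyl_q - weyl_q * weyl_p = 1.
Proof.
have /eqP : (commutator free_p free_q == 1 %[mod weyl]).
  by rewrite -idealrBE weyl_ideal_rel.
by rewrite /commutator weyl_pE weyl_qE !piE => ->.
Qed.

End WeylIdeal.

Section FreeEval.
Variables (K : fieldType) (A : algType K) (x y : A).

Definition word_val (m : {fmonom bool}) : A :=
  \prod_(b <- (m : seq bool)) (if b then x else y).

Lemma word_val_is_mmorphism : mmorphism word_val.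
Proof.
split; last by rewrite /word_val fm1 big_nil.
by move=> m1 m2; rewrite /word_val fmM big_cat.
Qed.

HB.instance Definition _ :=
  monalg.isMultiplicative.Build _ _ word_val word_val_is_mmorphism.

Definition free_eval : {malg K[{fmonom bool}]} -> A :=
  mmap (in_alg A) word_val.

Lemma free_eval_is_linear : linear free_eval.
Proof.
move=> c a b; rewrite /free_eval raddfD /= mmapZ.
by rewrite -mulr_algl.
Qed.
Lemma free_eval_is_monoid_morphism : monoid_morphism free_eval.
Proof.
have [] := @commr_mmap_is_multiplicative _ _ _ (in_alg A) word_val _.
  by move=> g m m'; rewrite /GRing.comm /= mulr_algl mulr_algr.
by move=> fM f1; split.
Qed.
HB.instance Definition _ :=
  GRing.isLinear.Build K {malg K[{fmonom bool}]} A _ free_eval free_eval_is_linear.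
HB.instance Definition _ :=
  GRing.isMonoidMorphism.Build {malg K[{fmonom bool}]} A free_eval
     free_eval_is_monoid_morphism.

Lemma free_eval_p : free_eval (free_p K) = x.
Proof. by rewrite /free_eval mmapU /= scale1r mul1r /word_val fmU big_seq1. Qed.

Lemma free_eval_q : free_eval (free_q K) = y.
Proof. by rewrite /free_eval mmapU /= scale1r mul1r /word_val fmU big_seq1. Qed.

Lemma free_eval_ideal a :
  commutator x y = 1 -> a \in @weyl_ideal K -> free_eval a = 0.
Proof.
move=> xy1 /asboolP/(_ [set a | free_eval a = 0]%classic); apply => /=.
  split=> [|b c b0 c0|b u c u0] /=; first exact: raddf0.
    by rewrite raddfB /= b0 c0 subr0.
  by rewrite !rmorphM /= u0 mulr0 mul0r.
have H u v : free_eval (commutator u v - 1) =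
    commutator (free_eval u) (free_eval v) - 1.
  by rewrite raddfB /= rmorph_commutator rmorph1.
by rewrite H free_eval_p free_eval_q xy1 subrr.
Qed.

Definition weyl_lift of commutator x y = 1 := fun w : weyl K =>
  free_eval (repr w).

Hypothesis xy1 : commutator x y = 1.
Local Notation lift := (weyl_lift xy1).

Lemma weyl_lift_pi a : lift (\pi a) = free_eval a.
Proof.
apply/eqP; rewrite -subr_eq0 -raddfB; apply/eqP/free_eval_ideal => //.
by rewrite idealrBE reprK.
Qed.

Lemma weyl_lift_is_linear : linear lift.
Proof.
move=> c v w; rewrite -[v]reprK -[w]reprK.
by rewrite -pi_weylZ -pi_weylD !weyl_lift_pi linearP.
Qed.

Lemma weyl_lift_is_monoid_morphism : monoid_morphism lift.
Proof.
split; first by rewrite -pi_weyl1 weyl_lift_pi rmorph1.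
move=> v w; rewrite -[v]reprK -[w]reprK.
by rewrite -pi_weylM !weyl_lift_pi rmorphM.
Qed.

HB.instance Definition _ :=
  GRing.isLinear.Build K (weyl K) A _ lift weyl_lift_is_linear.
HB.instance Definition _ :=
  GRing.isMonoidMorphism.Build (weyl K) A lift weyl_lift_is_monoid_morphism.

Lemma weyl_lift_p : lift (weyl_p K) = x.
Proof. by rewrite weyl_pE weyl_lift_pi free_eval_p. Qed.

Lemma weyl_lift_q : lift (weyl_q K) = y.
Proof. by rewrite weyl_qE weyl_lift_pi free_eval_q. Qed.

End FreeEval.

Section WeylTheory.
Variable K : fieldType.

Lemma pi_free_eval (a : {malg K[{fmonom bool}]}) :
  \pi_(weyl K) a = free_eval (weyl_p K) (weyl_q K) a.
Proof.
rewrite [in LHS](monalgE a) /free_eval mmapE raddf_sum; apply: eq_bigr => k _.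
rewrite /= mulr_algl.
have -> : << a@_k *g k >> = a@_k *: << k >> :> {malg K[{fmonom bool}]}.
  exact: malgUZ.
rewrite pi_weylZ; congr (_ *: _); case: k => s; rewrite /word_val /=.
elim: s => [|b s IHs]; first by rewrite big_nil -fmoneE pi_weyl1.
rewrite big_cons -IHs.
have -> : << FMonom (b :: s) >>
    = << fmu b >> * << FMonom s >> :> {malg K[{fmonom bool}]}.
  by rewrite malgM_def fgmulUU mulr1 fmuE /mmul /= fmmulE.
by rewrite pi_weylM; case: b; rewrite (weyl_pE, weyl_qE).
Qed.

Lemma weyl_ext (A : algType K) (f g : {lrmorphism weyl K -> A}) :
  f (weyl_p K) = g (weyl_p K) -> f (weyl_q K) = g (weyl_q K) -> f =1 g.
Proof.
move=> fgp fgq w; rewrite -[w]reprK pi_free_eval /free_eval mmapE !raddf_sum.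
apply: eq_bigr => k _ /=; rewrite !mulr_algl !linearZ /=; congr (_ *: _).
rewrite /word_val !rmorph_prod; apply: eq_bigr => b _; by case: b.
Qed.

Definition weyl_act (w : weyl K) (f : {poly K}) : {poly K} :=
  free_act (repr w) f.

Lemma weyl_act_pi a f : weyl_act (\pi a) f = free_act a f.
Proof.
apply/eqP; rewrite -subr_eq0 -free_actB; apply/eqP/free_act_ideal.
by rewrite idealrBE reprK.
Qed.

Lemma weyl_act_is_linear w : linear (weyl_act w).
Proof.
move=> c f g; rewrite /weyl_act /free_act !mmapE scaler_sumr -big_split /=.
by apply: eq_bigr => k _; rewrite linearP mulrDr -scalerAr.
Qed.
HB.instance Definition _ w :=
  GRing.isLinear.Build K {poly K} {poly K} _ (weyl_act w) (weyl_act_is_linear w).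

Lemma weyl_actD v w f : weyl_act (v + w) f = weyl_act v f + weyl_act w f.
Proof.
rewrite -[v]reprK -[w]reprK.
by rewrite -pi_weylD !weyl_act_pi /free_act raddfD.
Qed.

Lemma weyl_actZ c w f : weyl_act (c *: w) f = c *: weyl_act w f.
Proof.
rewrite -[w]reprK.
rewrite -pi_weylZ !weyl_act_pi /free_act (mmapEw (msuppZ_le _ _)) mmapE scaler_sumr.
by apply: eq_bigr => k _; rewrite mcoeffZ /= polyCM -mulrA mul_polyC.
Qed.

Lemma weyl_actM v w f : weyl_act (v * w) f = weyl_act v (weyl_act w f).
Proof.
rewrite -[v]reprK -[w]reprK.
by rewrite -pi_weylM !weyl_act_pi free_actM.
Qed.

Lemma weyl_act_p f : weyl_act (weyl_p K) f = f^`().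
Proof. by rewrite weyl_pE weyl_act_pi free_act_p. Qed.

Lemma weyl_act_q f : weyl_act (weyl_q K) f = 'X * f.
Proof. by rewrite weyl_qE weyl_act_pi free_act_q. Qed.

End WeylTheory.

Section Bijections.
Variable T : choiceType.

Definition bijection := {f : T -> T | `[< bijective f >]}.
HB.instance Definition _ := SubChoice.on bijection.

Definition bijection_fun (f : bijection) : T -> T := val f.
Coercion bijection_fun : bijection >-> Funclass.

Lemma bijectionP (f g : bijection) : f =1 g -> f = g.
Proof. by move=> fg; apply/val_inj/funext. Qed.

Lemma bijection_bij (f : bijection) : bijective f.
Proof. exact/asboolP/(valP f). Qed.

Definition mk_bijection f (fbij : bijective f) : bijection :=
  exist _ f (asboolT fbij).

Definition bijection_mul (f g : bijection) : bijection :=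
  mk_bijection (bij_comp (bijection_bij f) (bijection_bij g)).

Definition bijection_one : bijection := mk_bijection (@inv_bij T id (fun=> erefl)).

Lemma bijection_has_inv (f : bijection) : exists g, cancel f g /\ cancel g f.
Proof. by case: (bijection_bij f) => g fK gK; exists g. Qed.

Definition bijection_inv (f : bijection) : bijection :=
  let: exist g gP := cid (bijection_has_inv f) in
  mk_bijection (Bijective gP.2 gP.1).

Fact bijection_invK (f : bijection) : cancel f (bijection_inv f).
Proof. by rewrite /bijection_inv; case: cid => g [] . Qed.

Fact bijection_Kinv (f : bijection) : cancel (bijection_inv f) f.
Proof. by rewrite /bijection_inv; case: cid => g [] . Qed.

Fact bijection_mulA : associative bijection_mul.
Proof. by move=> f g h; apply: bijectionP. Qed.
Fact bijection_mul1 : left_id bijection_one bijection_mul.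
Proof. by move=> f; apply: bijectionP. Qed.
Fact bijection_mulr1 : right_id bijection_one bijection_mul.
Proof. by move=> f; apply: bijectionP. Qed.
Fact bijection_mulV : left_inverse bijection_one bijection_inv bijection_mul.
Proof. by move=> f; apply: bijectionP => x; apply: bijection_invK. Qed.
Fact bijection_mulVr : right_inverse bijection_one bijection_inv bijection_mul.
Proof. by move=> f; apply: bijectionP => x; apply: bijection_Kinv. Qed.

HB.instance Definition _ := isGroup.Build bijection
  bijection_mulA bijection_mul1 bijection_mulr1 bijection_mulV bijection_mulVr.

End Bijections.

Section AlgebraAutomorphisms.
Variables (K : comNzRingType) (A : algType K).

Definition is_alg_aut : {pred bijection A} := fun f =>
  `[< linear f /\ monoid_morphism f >].

Lemma is_alg_aut_div (f g : bijection A) :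
  is_alg_aut f -> is_alg_aut g -> is_alg_aut (f / g)%g.
Proof.
move=> /asboolP[flin [f1 fM]] /asboolP[glin [g1 gM]].
have gK : cancel (bijection_inv g) g by exact: bijection_Kinv.
have ginj : injective g := bij_inj (bijection_bij g).
apply/asboolP; split=> [c x y|]; last split=> [|x y].
- rewrite /= -flin; congr (f _); apply: ginj.
  by rewrite glin !gK.
- by rewrite -[RHS]f1; congr (f _); apply: ginj; rewrite gK g1.
- by rewrite -fM; congr (f _); apply: ginj; rewrite gM !gK.
Qed.

Lemma alg_aut_group_closed : group_closed is_alg_aut.
Proof. by split; [apply/asboolP | exact: is_alg_aut_div]. Qed.

Definition alg_aut := {f : bijection A | is_alg_aut f}.
HB.instance Definition _ := SubChoice.on alg_aut.
HB.instance Definition _ :=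
  SubChoice_isSubGroup.Build (bijection A) is_alg_aut alg_aut alg_aut_group_closed.

Definition alg_aut_fun (f : alg_aut) : A -> A := bijection_fun (val f).
Coercion alg_aut_fun : alg_aut >-> Funclass.

Lemma alg_aut_is_linear (f : alg_aut) : linear f.
Proof. by case/asboolP: (valP f). Qed.
Lemma alg_aut_is_monoid_morphism (f : alg_aut) : monoid_morphism f.
Proof. by case/asboolP: (valP f). Qed.
HB.instance Definition _ (f : alg_aut) :=
  GRing.isLinear.Build K A A _ (alg_aut_fun f) (alg_aut_is_linear f).
HB.instance Definition _ (f : alg_aut) :=
  GRing.isMonoidMorphism.Build A A (alg_aut_fun f) (alg_aut_is_monoid_morphism f).

Lemma alg_autP (f g : alg_aut) : f =1 g -> f = g.
Proof. by move=> fg; apply/val_inj/bijectionP. Qed.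

Definition mk_alg_aut (f : A -> A) (fbij : bijective f) (flin : linear f)
    (fM : monoid_morphism f) : alg_aut :=
  exist _ (mk_bijection fbij) (asboolT (conj flin fM)).

End AlgebraAutomorphisms.

Definition lie_morphism (K : pzRingType) (L M : lieAlgType K) (f : L -> M) : Prop :=
  linear f /\ {morph f : x y / lie x y}.

Section LieAutomorphisms.
Variables (K : pzRingType) (L : lieAlgType K).

Definition is_lie_aut : {pred bijection L} := fun f => `[< lie_morphism f >].

Lemma is_lie_aut_div (f g : bijection L) :
  is_lie_aut f -> is_lie_aut g -> is_lie_aut (f / g)%g.
Proof.
move=> /asboolP[flin fM] /asboolP[glin gM].
have gK : cancel (bijection_inv g) g by exact: bijection_Kinv.
have ginj : injective g := bij_inj (bijection_bij g).
apply/asboolP; split=> [c x y|x y].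
- by rewrite /= -flin; congr (f _); apply: ginj; rewrite glin !gK.
- by rewrite -fM; congr (f _); apply: ginj; rewrite gM !gK.
Qed.

Lemma lie_aut_group_closed : group_closed is_lie_aut.
Proof. by split; [apply/asboolP | exact: is_lie_aut_div]. Qed.

Definition lie_aut := {f : bijection L | is_lie_aut f}.
HB.instance Definition _ := SubChoice.on lie_aut.
HB.instance Definition _ :=
  SubChoice_isSubGroup.Build (bijection L) is_lie_aut lie_aut lie_aut_group_closed.

Definition lie_aut_fun (f : lie_aut) : L -> L := bijection_fun (val f).
Coercion lie_aut_fun : lie_aut >-> Funclass.

Lemma lie_aut_is_linear (f : lie_aut) : linear f.
Proof. by case/asboolP: (valP f). Qed.
HB.instance Definition _ (f : lie_aut) :=
  GRing.isLinear.Build K L L _ (lie_aut_fun f) (lie_aut_is_linear f).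
Lemma lie_aut_lie (f : lie_aut) : {morph f : x y / lie x y}.
Proof. by case/asboolP: (valP f). Qed.

Lemma lie_autP (f g : lie_aut) : f =1 g -> f = g.
Proof. by move=> fg; apply/val_inj/bijectionP. Qed.

Definition mk_lie_aut (f : L -> L) (fbij : bijective f) (fM : lie_morphism f) :
  lie_aut := exist _ (mk_bijection fbij) (asboolT fM).

End LieAutomorphisms.

Lemma det_mx22 (K : comNzRingType) (g : 'M[K]_2) :
  \det g = g 0 0 * g 1 1 - g 0 1 * g 1 0.
Proof.
rewrite (expand_det_row _ 0) !big_ord_recl big_ord0 addr0 /cofactor !det_mx11 !mxE.
rewrite /= expr0 expr1 mul1r mulN1r mulrN.
by congr (g _ _ * g _ _ - g _ _ * g _ _); apply: val_inj.
Qed.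

Section SL2.
Variable K : fieldType.

Definition traceless : {pred 'M[K]_2} := fun x => \tr x == 0.

Lemma traceless_subsemimod_closed : subsemimod_closed traceless.
Proof.
split; first split.
- by rewrite unfold_in linear0.
- by move=> x y; rewrite !unfold_in linearD /= => /eqP -> /eqP ->; rewrite addr0.
- by move=> c x; rewrite !unfold_in linearZ /= => /eqP ->; rewrite mulr0.
Qed.

Definition sl2 := {x : 'M[K]_2 | traceless x}.
HB.instance Definition _ := SubChoice.on sl2.
HB.instance Definition _ :=
  GRing.SubChoice_isSubLmodule.Build K 'M[K]_2 traceless sl2
    traceless_subsemimod_closed.

Definition mk_sl2 (x : 'M[K]_2) (xP : traceless x) : sl2 := exist _ x xP.

Lemma traceless_commutator (x y : 'M[K]_2) : traceless (commutator x y).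
Proof. by rewrite /traceless linearB /= mxtrace_mulC subrr. Qed.

Definition sl2_lie (x y : sl2) : sl2 :=
  exist _ (commutator (val x) (val y)) (traceless_commutator _ _).

Fact sl2_lie_linearl (a : K) (x y z : sl2) :
  sl2_lie (a *: x + y) z = a *: sl2_lie x z + sl2_lie y z.
Proof.
apply: val_inj.
exact: (commutator_linearl (A := 'M[K]_2)).
Qed.
Fact sl2_lie_linearr (a : K) (x y z : sl2) :
  sl2_lie x (a *: y + z) = a *: sl2_lie x y + sl2_lie x z.
Proof.
apply: val_inj.
exact: (commutator_linearr (A := 'M[K]_2)).
Qed.
Fact sl2_liexx (x : sl2) : sl2_lie x x = 0.
Proof. by apply: val_inj; rewrite /= commutatorxx. Qed.
Fact sl2_lie_jacobi (x y z : sl2) :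
  sl2_lie x (sl2_lie y z) + sl2_lie y (sl2_lie z x) + sl2_lie z (sl2_lie x y) = 0.
Proof. by apply: val_inj; apply: (commutator_jacobi (A := 'M[K]_2)). Qed.

HB.instance Definition _ := Lmodule_isLie.Build K sl2
  sl2_lie_linearl sl2_lie_linearr sl2_liexx sl2_lie_jacobi.

Fact traceless_e_plus : traceless (delta_mx 0 1).
Proof. by rewrite /traceless /mxtrace !big_ord_recl big_ord0 !mxE /= !addr0. Qed.
Fact traceless_e_minus : traceless (delta_mx 1 0).
Proof. by rewrite /traceless /mxtrace !big_ord_recl big_ord0 !mxE /= !addr0. Qed.
Fact traceless_e_0 : traceless (delta_mx 0 0 - delta_mx 1 1).
Proof.
by rewrite /traceless /mxtrace !big_ord_recl big_ord0 !mxE /= subr0 sub0r addr0 subrr.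
Qed.

Definition e_plus : sl2 := mk_sl2 traceless_e_plus.
Definition e_minus : sl2 := mk_sl2 traceless_e_minus.
Definition e_0 : sl2 := mk_sl2 traceless_e_0.

Definition SL2 := {g : 'M[K]_2 | \det g == 1}.
HB.instance Definition _ := SubChoice.on SL2.

Definition mk_SL2 (g : 'M[K]_2) (gP : \det g == 1) : SL2 :=
  exist (fun g : 'M[K]_2 => is_true (\det g == 1)) g gP.

Lemma SL2_unit (g : SL2) : val g \in unitmx.
Proof. by rewrite unitmxE (eqP (valP g)) unitr1. Qed.

Fact SL2_mul_subproof (g h : SL2) : \det (val g *m val h) == 1.
Proof. by rewrite det_mulmx (eqP (valP g)) (eqP (valP h)) mulr1. Qed.
Fact SL2_one_subproof : \det (1%:M : 'M[K]_2) == 1.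
Proof. by rewrite det1. Qed.
Fact SL2_inv_subproof (g : SL2) : \det (invmx (val g)) == 1.
Proof. by rewrite det_inv (eqP (valP g)) invr1. Qed.

Definition SL2_mul (g h : SL2) : SL2 := mk_SL2 (SL2_mul_subproof g h).
Definition SL2_one : SL2 := mk_SL2 SL2_one_subproof.
Definition SL2_inv (g : SL2) : SL2 := mk_SL2 (SL2_inv_subproof g).

Fact SL2_mulA : associative SL2_mul.
Proof. by move=> g h k; apply: val_inj; rewrite /= mulmxA. Qed.
Fact SL2_mul1 : left_id SL2_one SL2_mul.
Proof. by move=> g; apply: val_inj; rewrite /= mul1mx. Qed.
Fact SL2_mulr1 : right_id SL2_one SL2_mul.
Proof. by move=> g; apply: val_inj; rewrite /= mulmx1. Qed.
Fact SL2_mulV : left_inverse SL2_one SL2_inv SL2_mul.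
Proof. by move=> g; apply: val_inj; rewrite /= mulVmx ?SL2_unit. Qed.
Fact SL2_mulVr : right_inverse SL2_one SL2_inv SL2_mul.
Proof. by move=> g; apply: val_inj; rewrite /= mulmxV ?SL2_unit. Qed.

HB.instance Definition _ := isGroup.Build SL2
  SL2_mulA SL2_mul1 SL2_mulr1 SL2_mulV SL2_mulVr.

Fact traceless_Ad (g : SL2) (x : sl2) :
  traceless (val g *m val x *m invmx (val g)).
Proof.
by rewrite /traceless mxtrace_mulC mulmxA mulVmx ?SL2_unit // mul1mx; apply: (valP x).
Qed.

Definition Ad_fun (g : SL2) (x : sl2) : sl2 := mk_sl2 (traceless_Ad g x).

Lemma Ad_fun1 x : Ad_fun 1%g x = x.
Proof. by apply: val_inj; rewrite /= invmx1 mul1mx mulmx1. Qed.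

Lemma Ad_funM g h x : Ad_fun (g * h)%g x = Ad_fun g (Ad_fun h x).
Proof.
apply: val_inj; rewrite /=.
have -> : invmx (val g *m val h) = invmx (val h) *m invmx (val g).
  have gh : val g *m val h \in unitmx by rewrite unitmx_mul !SL2_unit.
  apply: (can_inj (mulKmx gh)); rewrite mulmxV //.
  by rewrite -mulmxA (mulmxA (val h)) mulmxV ?SL2_unit // mul1mx mulmxV ?SL2_unit.
by rewrite !mulmxA.
Qed.

Lemma Ad_fun_bij g : bijective (Ad_fun g).
Proof.
by exists (Ad_fun g^-1%g) => x; rewrite -Ad_funM ?mulVg ?mulgV Ad_fun1.
Qed.

Lemma Ad_fun_lie_morphism g : lie_morphism (Ad_fun g).
Proof.
split=> [c x y|x y]; apply: val_inj.
  change (val g *m (c *: val x + val y) *m invmx (val g) =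
    c *: (val g *m val x *m invmx (val g)) + val g *m val y *m invmx (val g)).
  by rewrite mulmxDr mulmxDl -scalemxAr -scalemxAl.
have E (a b : 'M[K]_2) : val g *m (a *m b) *m invmx (val g) =
    (val g *m a *m invmx (val g)) *m (val g *m b *m invmx (val g)).
  rewrite !mulmxA; congr (_ *m _ *m _).
  by rewrite -[in RHS]mulmxA mulVmx ?SL2_unit // mulmx1.
by rewrite /= /commutator mulmxBr mulmxBl !E.
Qed.

Definition Ad (g : SL2) : lie_aut sl2 :=
  mk_lie_aut (Ad_fun_bij g) (Ad_fun_lie_morphism g).

Lemma AdM : {morph Ad : g h / (g * h)%g}.
Proof. by move=> g h; apply: lie_autP => x; apply: Ad_funM. Qed.
HB.instance Definition _ :=
  monoid.isMultiplicative.Build SL2 (lie_aut sl2) Ad AdM.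

Definition alpha1_p (g : SL2) : weyl K :=
  val g 0 1 *: weyl_q K + val g 1 1 *: weyl_p K.
Definition alpha1_q (g : SL2) : weyl K :=
  val g 0 0 *: weyl_q K + val g 1 0 *: weyl_p K.

Lemma alpha1_rel g : commutator (alpha1_p g) (alpha1_q g) = 1.
Proof.
have dg : val g 0 0 * val g 1 1 - val g 0 1 * val g 1 0 = 1.
  by rewrite -det_mx22; apply/eqP/(valP g).
rewrite /alpha1_p /alpha1_q !(commutatorDl, commutatorDr) !(commutatorZl, commutatorZr).
rewrite !commutatorxx -[commutator (weyl_q K) _]opprB -/(commutator _ _).
rewrite [commutator (weyl_p K) _]weyl_pq !scaler0 add0r addr0 !scalerN !scalerA.
by rewrite -scaleNr -scalerDl addrC mulrC dg scale1r.
Qed.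

Definition alpha1_fun (g : SL2) : weyl K -> weyl K := weyl_lift (alpha1_rel g).
HB.instance Definition _ g := GRing.LRMorphism.on (alpha1_fun g).

Lemma alpha1_fun_p g : alpha1_fun g (weyl_p K) = alpha1_p g.
Proof. exact: weyl_lift_p. Qed.
Lemma alpha1_fun_q g : alpha1_fun g (weyl_q K) = alpha1_q g.
Proof. exact: weyl_lift_q. Qed.

Lemma alpha1_fun1 x : alpha1_fun 1%g x = x.
Proof.
apply: (weyl_ext (f := alpha1_fun 1%g) (g := idfun)) => /=.
  by rewrite alpha1_fun_p /alpha1_p !mxE /= scale0r scale1r add0r.
by rewrite alpha1_fun_q /alpha1_q !mxE /= scale0r scale1r addr0.
Qed.

Lemma alpha1_funM g h x : alpha1_fun (g * h)%g x = alpha1_fun g (alpha1_fun h x).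
Proof.
have mE i j : val (g * h)%g i j = val g i 0 * val h 0 j + val g i 1 * val h 1 j.
  by rewrite /= mxE !big_ord_recl big_ord0 addr0; congr (_ + val g _ _ * val h _ _);
    apply: val_inj.
apply: (weyl_ext (f := alpha1_fun (g * h)%g) (g := alpha1_fun g \o alpha1_fun h)) => /=.
  rewrite !alpha1_fun_p [alpha1_p h]/alpha1_p linearD !linearZ /=.
  rewrite alpha1_fun_p alpha1_fun_q /alpha1_p /alpha1_q !mE.
  by rewrite !scalerDr !scalerA !scalerDl ![val h _ _ * _]mulrC addrACA.
rewrite !alpha1_fun_q [alpha1_q h]/alpha1_q linearD !linearZ /=.
rewrite alpha1_fun_p alpha1_fun_q /alpha1_p /alpha1_q !mE.
by rewrite !scalerDr !scalerA !scalerDl ![val h _ _ * _]mulrC addrACA.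
Qed.

Lemma alpha1_fun_bij g : bijective (alpha1_fun g).
Proof.
by exists (alpha1_fun g^-1%g) => x; rewrite -alpha1_funM ?mulVg ?mulgV alpha1_fun1.
Qed.

Lemma alpha1_fun_is_linear g : linear (alpha1_fun g).
Proof. exact: linearP. Qed.
Lemma alpha1_fun_is_monoid_morphism g : monoid_morphism (alpha1_fun g).
Proof. by split=> [|x y]; rewrite (rmorph1, rmorphM). Qed.

Definition alpha1 (g : SL2) : alg_aut (weyl K) :=
  mk_alg_aut (alpha1_fun_bij g) (alpha1_fun_is_linear g)
    (alpha1_fun_is_monoid_morphism g).

Lemma alpha1M : {morph alpha1 : g h / (g * h)%g}.
Proof. by move=> g h; apply: alg_autP => x; apply: alpha1_funM. Qed.
HB.instance Definition _ :=
  monoid.isMultiplicative.Build SL2 (alg_aut (weyl K)) alpha1 alpha1M.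

Lemma alpha1_pE g :
  alpha1 g (weyl_p K) = val g 0 1 *: weyl_q K + val g 1 1 *: weyl_p K.
Proof. exact: alpha1_fun_p. Qed.
Lemma alpha1_qE g :
  alpha1 g (weyl_q K) = val g 0 0 *: weyl_q K + val g 1 0 *: weyl_p K.
Proof. exact: alpha1_fun_q. Qed.

End SL2.

Section Embeddings.
Variable K : fieldType.

Definition is_sl2_emb : {pred (sl2 K -> weyl K)} := fun f =>
  `[< lie_morphism f /\ injective f >].

Definition sl2_emb := {f : sl2 K -> weyl K | is_sl2_emb f}.

Definition sl2_emb_fun (f : sl2_emb) : sl2 K -> weyl K := val f.
Coercion sl2_emb_fun : sl2_emb >-> Funclass.

Lemma sl2_embP (f g : sl2_emb) : f =1 g -> f = g.
Proof. by move=> fg; apply/val_inj/funext. Qed.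

Lemma sl2_emb_lie_morphism (f : sl2_emb) : lie_morphism f.
Proof. by case/asboolP: (valP f). Qed.
Lemma sl2_emb_inj (f : sl2_emb) : injective f.
Proof. by case/asboolP: (valP f). Qed.

Definition mk_sl2_emb (f : sl2 K -> weyl K) (fL : lie_morphism f)
  (finj : injective f) : sl2_emb := exist _ f (asboolT (conj fL finj)).

Definition aut_group := (alg_aut (weyl K) * lie_aut (sl2 K))%type.
HB.instance Definition _ := Group.on aut_group.

Definition emb_act_fun (c : aut_group) (f : sl2_emb) (x : sl2 K) : weyl K :=
  c.1 (f (((c.2^-1)%g : lie_aut (sl2 K)) x)).

Lemma emb_act_fun_lie_morphism c f : lie_morphism (emb_act_fun c f).
Proof.
have [flin fL] := sl2_emb_lie_morphism f.
split=> [a x y|x y]; rewrite /emb_act_fun; first by rewrite linearP flin linearP.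
by rewrite lie_aut_lie fL; apply: (rmorph_commutator c.1).
Qed.

Lemma emb_act_fun_inj c f : injective (emb_act_fun c f).
Proof.
move=> x y /(bij_inj (bijection_bij (val c.1)))/sl2_emb_inj.
exact: (bij_inj (bijection_bij (val (c.2^-1)%g))).
Qed.

Definition emb_act (c : aut_group) (f : sl2_emb) : sl2_emb :=
  mk_sl2_emb (emb_act_fun_lie_morphism c f) (@emb_act_fun_inj c f).

Lemma emb_act1 f : emb_act 1%g f = f.
Proof.
apply: sl2_embP => x.
have e : (1^-1)%g = 1%g :> lie_aut (sl2 K) by exact: invg1.
exact (congr1 (fun w : lie_aut (sl2 K) => f (w x)) e).
Qed.

Lemma emb_actM c d f : emb_act (c * d)%g f = emb_act c (emb_act d f).
Proof.
apply: sl2_embP => x.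
have e : ((c.2 * d.2)^-1)%g = (d.2^-1 * c.2^-1)%g :> lie_aut (sl2 K).
  exact: invgM.
exact (congr1 (fun w : lie_aut (sl2 K) => c.1 (d.1 (f (w x)))) e).
Qed.

Definition isotropy (f : sl2_emb) : set aut_group :=
  [set c | emb_act c f = f]%classic.

Lemma isotropy_group_closed f : group_closed (mem (isotropy f)).
Proof.
split=> [|c d]; first by rewrite inE /isotropy /= emb_act1.
rewrite !inE /isotropy /= => cf df; rewrite emb_actM.
have -> : emb_act d^-1%g f = f by rewrite -[in LHS]df -emb_actM mulVg emb_act1.
exact: cf.
Qed.

Definition isotropy_group (f : sl2_emb) := {c : aut_group | c \in isotropy f}.
HB.instance Definition _ f := SubChoice.on (isotropy_group f).
HB.instance Definition _ f :=
  SubChoice_isSubGroup.Build aut_group (fun c => c \in isotropy f)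
    (isotropy_group f) (isotropy_group_closed f).

End Embeddings.

Section WeylTriple.
Variables (K : numFieldType) (A : algType K) (p q : A).
Hypothesis comm_pq : commutator p q = 1.

Let comm_qp : commutator q p = -1.
Proof. by rewrite commutator_anti comm_pq. Qed.

Let E : A := - (2^-1 *: q ^+ 2).
Let F : A := 2^-1 *: p ^+ 2.
Let H : A := 2^-1 *: (p * q + q * p).

Let simpl0 := (mulr0, mul0r, mulr1, mul1r, addr0, add0r, mulrN1, mulN1r).

Let sum4 (u : A) : u + u + (u + u) = 4 *: u.
Proof. by rewrite scaler_nat -!mulr2n -mulrnA. Qed.

Lemma weyl_triple_HE : commutator H E = 2 *: E.
Proof.
rewrite /H /E commutatorZl commutatorNr commutatorZr !expr2.
have -> : commutator (p * q + q * p) (q * q) = 4 *: (q * q).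
  rewrite commutatorDl !commutatorMl !commutatorMr comm_pq commutatorxx !simpl0.
  by rewrite mulrDl mulrDr sum4.
by rewrite !scalerN !scalerA; congr (- (_ *: _)); field.
Qed.

Lemma weyl_triple_HF : commutator H F = - (2 *: F).
Proof.
rewrite /H /F commutatorZl commutatorZr !expr2.
have -> : commutator (p * q + q * p) (p * p) = - (4 *: (p * p)).
  rewrite commutatorDl !commutatorMl !commutatorMr comm_qp commutatorxx !simpl0.
  by rewrite mulrDl mulrDr !mulrN !mulNr -!opprD sum4.
by rewrite !scalerN !scalerA; congr (- (_ *: _)); field.
Qed.

Lemma weyl_triple_EF : commutator E F = H.
Proof.
rewrite /E /F /H commutatorNl commutatorZl commutatorZr !expr2.
have -> : commutator (q * q) (p * p) = - (2 *: (p * q + q * p)).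
  rewrite !commutatorMl !commutatorMr comm_qp !simpl0 -opprD mulrN mulNr -opprD.
  by rewrite mulrDr mulrDl scaler_nat mulr2n addrC addrACA.
by rewrite !scalerN opprK !scalerA; congr (_ *: _); field.
Qed.

Lemma weyl_triple_commutator (a b c a' b' c' : K) :
  commutator (a *: E + b *: F + c *: H) (a' *: E + b' *: F + c' *: H) =
  (2 * (c * a' - a * c')) *: E + (2 * (b * c' - c * b')) *: F
  + (a * b' - b * a') *: H.
Proof.
move: weyl_triple_HE weyl_triple_HF weyl_triple_EF; rewrite -/E -/F -/H.
move: E F H => e f h he hf ef.
rewrite !(commutatorDl, commutatorDr) !(commutatorZl, commutatorZr) !commutatorxx.
rewrite [commutator f h]commutator_anti [commutator e h]commutator_anti.
rewrite [commutator f e]commutator_anti he hf ef.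
rewrite opprK !scaler0 !scalerN !scalerA !add0r !addr0.
rewrite ![2 * _]mulrC !mulrBl !scalerBl.
by rewrite [LHS](AC ((2*2)*2) ((5*2)*(4*6)*(1*3))).
Qed.

End WeylTriple.

Lemma lin3_congr (K : nzRingType) (V : lmodType K) (a b c a' b' c' : K) (x y z : V) :
  a = a' -> b = b' -> c = c' ->
  a *: x + b *: y + c *: z = a' *: x + b' *: y + c' *: z.
Proof. by move=> -> -> ->. Qed.

Section FI.
Variable K : numFieldType.
Local Notation p := (weyl_p K).
Local Notation q := (weyl_q K).

(* The linear map with e_+ |-> - q^2 / 2, e_- |-> p^2 / 2 and
   e_0 |-> (pq + qp) / 2: the coordinates of x in the basis (e_+, e_-, e_0) are
   x_01, x_10 and x_00. *)
Definition fI_fun (x : sl2 K) : weyl K :=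
  val x 0 1 *: (- (2^-1 *: q ^+ 2)) + val x 1 0 *: (2^-1 *: p ^+ 2)
  + val x 0 0 *: (2^-1 *: (p * q + q * p)).

Lemma fI_fun_is_linear : linear fI_fun.
Proof.
move=> c x y; rewrite /fI_fun !mxE.
move: (- (_ *: q ^+ 2)) (_ *: p ^+ 2) (_ *: (p * q + q * p)) => E F H.
rewrite !scalerDl !scalerDr !scalerA.
by rewrite [RHS]addrACA; congr (_ + _); exact: addrACA.
Qed.

Lemma sl2_11 (x : sl2 K) : val x 1 1 = - val x 0 0.
Proof.
have /eqP := valP x; rewrite /mxtrace !big_ord_recl big_ord0 addr0 => /eqP.
rewrite addr_eq0 => /eqP ->; rewrite opprK; congr (val x _ _); exact: val_inj.
Qed.

Lemma sl2_lieE (x y : sl2 K) i j :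
  val (lie x y) i j = (val x i 0 * val y 0 j + val x i 1 * val y 1 j)
                    - (val y i 0 * val x 0 j + val y i 1 * val x 1 j).
Proof.
have o1 : lift ord0 ord0 = 1 :> 'I_2 by apply: val_inj.
by rewrite /= !mxE !big_ord_recl !big_ord0 !addr0 !o1.
Qed.

Lemma fI_fun_lie_morphism : lie_morphism fI_fun.
Proof.
split; first exact: fI_fun_is_linear.
move=> x y; rewrite /fI_fun !sl2_lieE !sl2_11.
apply: etrans (esym (weyl_triple_commutator (weyl_pq K) _ _ _ _ _ _)).
by apply: lin3_congr; ring.
Qed.

Lemma fI_fun_act (x : sl2 K) (f : {poly K}) : weyl_act (fI_fun x) f =
  val x 0 1 *: (- (2^-1 *: ('X * ('X * f)))) + val x 1 0 *: (2^-1 *: f^`()^`())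
  + val x 0 0 *: (2^-1 *: (('X * f)^`() + 'X * f^`())).
Proof.
rewrite /fI_fun -!scaleN1r !expr2 !(weyl_actD, weyl_actZ).
rewrite (weyl_actM q q) (weyl_actM p p) (weyl_actM p q) (weyl_actM q p).
by rewrite !(weyl_act_p, weyl_act_q).
Qed.

Lemma fI_fun_inj : injective fI_fun.
Proof.
have n2 : 2^-1 != 0 :> K by rewrite invr_eq0 pnatr_eq0.
suff ker x : fI_fun x = 0 -> x = 0.
  move=> x y /eqP; rewrite -subr_eq0 => /eqP xy.
  apply/eqP; rewrite -subr_eq0; apply/eqP/ker; rewrite -xy.
  by rewrite -scaleN1r addrC fI_fun_is_linear scaleN1r addrC.
move=> x0.
have act0 f : weyl_act (fI_fun x) f = 0.
  by rewrite x0 -(scale0r 0) weyl_actZ scale0r.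
have := act0 1; rewrite fI_fun_act mulr1 derivX derivC raddf0 mulr0 !scaler0 !addr0 => h1.
have x00 : val x 0 0 = 0.
  move/(congr1 (fun f : {poly K} => f`_0)): (h1).
  rewrite !coefE /=. rewrite !(mulr0, oppr0) add0r mulr1 => /eqP; rewrite mulf_eq0 (negPf n2).
  by rewrite orbF => /eqP.
have x01 : val x 0 1 = 0.
  move/(congr1 (fun f : {poly K} => f`_2)): h1.
  rewrite !coefE /= => /eqP; rewrite !mulr0 addr0 mulr1 mulrN oppr_eq0 mulf_eq0 (negPf n2).
  by rewrite orbF => /eqP.
have x10 : val x 1 0 = 0.
  have := act0 ('X * 'X); rewrite fI_fun_act x00 x01 !scale0r add0r addr0.
  rewrite !derivM !derivX mul1r mulr1 derivD derivX.
  move/(congr1 (fun f : {poly K} => f`_0)).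
  rewrite !coefE /= => /eqP; rewrite !mulf_eq0 (negPf n2) orFb.
  by rewrite -[1 + 1]/(2%:R) pnatr_eq0 orbF => /eqP.
apply: val_inj; apply/matrixP => i j; rewrite [RHS]mxE.
case: i => [[|[|//]] ilt]; case: j => [[|[|//]] jlt].
- by rewrite -x00; congr (val x _ _); apply: val_inj.
- by rewrite -x01; congr (val x _ _); apply: val_inj.
- by rewrite -x10; congr (val x _ _); apply: val_inj.
- rewrite -[RHS]oppr0 -x00 -sl2_11.
  by congr (val x _ _); apply: val_inj.
Qed.

Definition fI : sl2_emb K := mk_sl2_emb fI_fun_lie_morphism fI_fun_inj.

Lemma fI_e_plus : fI (e_plus K) = - (2^-1 *: q ^+ 2).
Proof.
by rewrite /fI /= /sl2_emb_fun /= /fI_fun /= !mxE /= !scale0r scale1r !addr0.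
Qed.
Lemma fI_e_minus : fI (e_minus K) = 2^-1 *: p ^+ 2.
Proof.
by rewrite /fI /= /sl2_emb_fun /= /fI_fun /= !mxE /= !scale0r scale1r add0r addr0.
Qed.
Lemma fI_e_0 : fI (e_0 K) = 2^-1 *: (p * q + q * p).
Proof.
rewrite /fI /= /sl2_emb_fun /= /fI_fun /= !mxE /= !subr0.
by rewrite !scale0r scale1r !add0r.
Qed.

End FI.

(* Main.v *)
Require Import Defs.
From HB Require Import structures.
From mathcomp Require Import all_boot all_order all_algebra.
From mathcomp Require Import boolp classical_sets reals complex.
From mathcomp Require Import monalg ring.
Import GRing.Theory Num.Theory.
Local Open Scope ring_scope.

Set Implicit Arguments.
Unset Strict Implicit.

(** Through [fI], sl(2) becomes the space of quadratic forms in [p] and [q], and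
    the adjoint action of [g] becomes the linear substitution [alpha1 g]
    ([alpha1_fI]); hence every pair [(alpha1 g, Ad g)] stabilizes [fI].

    Conversely, let [(a, w)] stabilize [fI], which means that [a] maps [fI x] to
    [fI (w x)] ([isotropyP]). Every automorphism of sl(2) over an algebraically
    closed field is inner ([lie_aut_sl2_inner]), say [w = Ad g], and then
    [b = alpha1 g^-1 * a] fixes [fI] pointwise. It therefore fixes [p ^+ 2]
    and [p q]. Such an automorphism is [1] or [-1] on the generators
    ([square_fixed_scalar]): the element [x = b p] commutes with [x ^+ 2 = p ^+ 2],
    hence with [p]; the Euler relation [[p q, x] = - x] then reads
    [p [x, q] = x]; so [[x, q]] is central, hence a scalar, and its square is [1].
    Thus [a = alpha1 (g * s)] with [s] equal to [1] or [-1], and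
    [w = Ad g = Ad (g * s)].

    The facts on the Weyl algebra that this uses (cancellation of [p], no nonzero
    element anticommuting with [p], centre reduced to the scalars) are read off
    from the normal forms [sum_j f_j(q) p^j], which exist ([weyl_normal_form]) and
    are unique ([normal_form_inj]). Uniqueness also shows that [alpha1] is
    injective, so that [g |-> (alpha1 g, Ad g)] is an isomorphism from [SL2] onto
    the stabilizer. *)

(** * Normal forms in the Weyl algebra *)

Section NormalForm.
Variables (K : numFieldType) (A : algType K) (p q : A).
Hypothesis comm_pq : commutator p q = 1.
Implicit Types (f : {poly K}) (F G : {poly {poly K}}).

(** The ordered expression with the powers of [q] on the left: the coefficient
    of ['X^j] in [F] is a polynomial in [q], and ['X] stands for [p]. *)
Definition normal_form F : A := (map_poly (horner_alg q) F).[p].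

Lemma normal_formD F G : normal_form (F + G) = normal_form F + normal_form G.
Proof. by rewrite /normal_form rmorphD hornerD. Qed.

Lemma normal_formB F G : normal_form (F - G) = normal_form F - normal_form G.
Proof. by rewrite /normal_form rmorphB hornerD hornerN. Qed.

Lemma normal_formC f : normal_form f%:P = horner_alg q f.
Proof. by rewrite /normal_form map_polyC hornerC. Qed.

Lemma normal_formCM f F : normal_form (f%:P * F) = horner_alg q f * normal_form F.
Proof. by rewrite /normal_form rmorphM /= map_polyC hornerCM. Qed.

Lemma normal_formMX F : normal_form (F * 'X) = normal_form F * p.
Proof. by rewrite /normal_form rmorphM /= map_polyX hornerMX. Qed.

Lemma normal_formZ (c : K) F : normal_form (c%:P *: F) = c *: normal_form F.
Proof. by rewrite -mul_polyC normal_formCM horner_algC -scalerAl mul1r. Qed.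

Lemma commutator_horner_alg f : commutator p (horner_alg q f) = horner_alg q f^`().
Proof.
elim/poly_ind: f => [|f c IHf].
  by rewrite deriv0 raddf0 /commutator mulr0 mul0r subrr.
rewrite derivMXaddC !rmorphD !rmorphM /= horner_algX horner_algC.
rewrite commutatorDr commutatorMr IHf comm_pq mulr1.
by rewrite commutatorZr /commutator mulr1 mul1r subrr scaler0 addr0.
Qed.

Lemma map_derivMXaddC F f :
  map_poly (@deriv K) (F * 'X + f%:P) = map_poly (@deriv K) F * 'X + f^`()%:P.
Proof.
apply/polyP => i; rewrite !(coef_map, coefD, coefMX, coefC) /= derivD.
by case: i => [|i]; rewrite ?deriv0.
Qed.

(** In normal form the two inner derivations are partial derivatives: bracketing
    with [p] differentiates in [q], and bracketing with [q] differentiates in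
    [p]. *)
Lemma commutator_p_normal_form F :
  commutator p (normal_form F) = normal_form (map_poly (@deriv K) F).
Proof.
elim/poly_ind: F => [|F f IHF].
  by rewrite map_poly0 /normal_form raddf0 horner0 /commutator mulr0 mul0r subrr.
rewrite map_derivMXaddC !normal_formD !normal_formMX !normal_formC.
by rewrite commutatorDr commutatorMr commutatorxx mulr0 add0r IHF commutator_horner_alg.
Qed.

Lemma commutator_normal_form_q F : commutator (normal_form F) q = normal_form F^`().
Proof.
elim/poly_ind: F => [|F f IHF].
  by rewrite deriv0 /normal_form raddf0 horner0 /commutator mulr0 mul0r subrr.
rewrite derivMXaddC !normal_formD !normal_formMX normal_formC.
rewrite commutatorDl commutatorMl comm_pq mulr1 IHF.
suff -> : commutator (horner_alg q f) q = 0 by rewrite addr0.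
by rewrite /commutator -{2 3}(horner_algX q) -!rmorphM mulrC subrr.
Qed.

Lemma deriv_eq0 (S : nzRingType) (P : {poly S}) :
  (forall (x : S) n, x *+ n.+1 = 0 -> x = 0) -> P^`() = 0 -> P = (P`_0)%:P.
Proof.
move=> S0 P0; apply/polyP => -[|i]; rewrite coefC //=.
by apply: (S0 _ i); rewrite -coef_deriv P0 coef0.
Qed.

Lemma mulrSn_eq0_field (x : K) n : x *+ n.+1 = 0 -> x = 0.
Proof. by move=> /eqP; rewrite mulrn_eq0 /= => /eqP. Qed.

Lemma mulrSn_eq0_poly f n : f *+ n.+1 = 0 -> f = 0.
Proof.
move=> f0; apply/polyP => i; rewrite coef0; apply: (@mulrSn_eq0_field _ n).
by rewrite -coefMn f0 coef0.
Qed.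

(** Differentiating in [p], then in [q], lowers the degree, so in characteristic
    zero a vanishing normal form comes down to a constant [c] with [c%:A = 0],
    and [1 != 0]. *)
Lemma normal_form_eq0 F : normal_form F = 0 -> F = 0.
Proof.
have [n] := ubnP (size F); elim: n F => // n IHn F sF F0.
have [->//|Fn0] := eqVneq F 0.
have sF' : (size F^`() < n)%N.
  by apply: leq_trans (lt_size_deriv Fn0) _; rewrite -ltnS.
have F'0 : F^`() = 0.
  by apply: IHn => //; rewrite -commutator_normal_form_q F0 /commutator mulr0 mul0r subrr.
rewrite (deriv_eq0 mulrSn_eq0_poly F'0) in F0 *.
move: F`_0 F0 => f; rewrite normal_formC.
have [m] := ubnP (size f); elim: m f => // m IHm f sf f0.
have [->//|fn0] := eqVneq f 0.
have f'0 : f^`() = 0.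
  apply/polyC_inj/IHm; first by apply: leq_trans (lt_size_deriv fn0) _; rewrite -ltnS.
  by rewrite -commutator_horner_alg f0 /commutator mulr0 mul0r subrr.
rewrite (deriv_eq0 mulrSn_eq0_field f'0) in f0 *.
move/eqP: f0; rewrite horner_algC scaler_eq0 oner_eq0 orbF => /eqP ->.
by rewrite !polyC0.
Qed.

Lemma normal_form_inj : injective normal_form.
Proof.
move=> F G /eqP; rewrite -subr_eq0 -normal_formB => /eqP/normal_form_eq0/eqP.
by rewrite subr_eq0 => /eqP.
Qed.

Lemma size_map_deriv F : (size (map_poly (@deriv K) F) <= size F)%N.
Proof. exact: size_poly. Qed.

Hypothesis normal_form_onto : forall a, exists F, a = normal_form F.

(** The operators [F *+ n.+1 * 'X + F_q] are the left multiplication by [p]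
    ([n = 0]) and the anticommutator with [p] ([n = 1]); differentiation
    in [q] does not raise the degree in [p], hence the top coefficient survives. *)
Lemma addX_map_deriv_eq0 (n : nat) F :
  (F * 'X) *+ n.+1 + map_poly (@deriv K) F = 0 -> F = 0.
Proof.
move=> /(congr1 (fun G : {poly {poly K}} => G`_(size F))).
case sF : (size F) => [|m]; first by move=> _; apply/eqP; rewrite -size_poly_eq0 sF.
rewrite coefD coefMn coefMX coef0 /= [X in _ + X]nth_default ?addr0; last first.
  by rewrite -sF size_map_deriv.
by move=> /mulrSn_eq0_poly/eqP; rewrite -[m]/(m.+1.-1) -sF lead_coef_eq0 => /eqP.
Qed.

Lemma mulp_normal_form F :
  p * normal_form F = normal_form (F * 'X + map_poly (@deriv K) F).
Proof.
by rewrite normal_formD normal_formMX -commutator_p_normal_form /commutator addrC subrK.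
Qed.

Lemma mulp_eq0 a : p * a = 0 -> a = 0.
Proof.
have [F ->] := normal_form_onto a; rewrite mulp_normal_form => /normal_form_eq0.
by move=> /(@addX_map_deriv_eq0 0)->; rewrite /normal_form raddf0 horner0.
Qed.

Lemma mulpI a b : p * a = p * b -> a = b.
Proof.
by move=> /eqP; rewrite -subr_eq0 -mulrBr => /eqP/mulp_eq0/eqP; rewrite subr_eq0 => /eqP.
Qed.

(** What makes the centralizer of [p ^+ 2] equal to that of [p]. *)
Lemma anticommutes_p_eq0 a : p * a + a * p = 0 -> a = 0.
Proof.
have [F ->] := normal_form_onto a; rewrite mulp_normal_form -normal_formMX -normal_formD.
move=> /normal_form_eq0 H; suff -> : F = 0 by rewrite /normal_form raddf0 horner0.
by apply: (@addX_map_deriv_eq0 1); rewrite mulr2n -H addrAC.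
Qed.

Lemma center_scalar a :
  commutator p a = 0 -> commutator a q = 0 -> exists c : K, a = c%:A.
Proof.
have [F ->] := normal_form_onto a.
rewrite commutator_normal_form_q => pa0 /normal_form_eq0/(deriv_eq0 mulrSn_eq0_poly) FE.
move: pa0; rewrite FE; move: F`_0 => f; rewrite normal_formC commutator_horner_alg.
rewrite -normal_formC => /normal_form_eq0/eqP; rewrite polyC_eq0 => /eqP.
by move=> /(deriv_eq0 mulrSn_eq0_field) ->; exists f`_0; rewrite horner_algC.
Qed.

Lemma pq_free (a b c d : K) : a *: q + b *: p = c *: q + d *: p -> a = c /\ b = d.
Proof.
have E (s t : K) : s *: q + t *: p = normal_form (t%:P%:P * 'X + (s *: 'X)%:P).
  rewrite normal_formD normal_formMX !normal_formC horner_algC linearZ /= horner_algX.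
  by rewrite !mulr_algl addrC.
rewrite !E => /normal_form_inj H; split.
  have := congr1 (fun G : {poly {poly K}} => G`_0`_1) H.
  by rewrite !coefD !coefMX !coefC /= !add0r !coefZ !coefX !mulr1.
have := congr1 (fun G : {poly {poly K}} => G`_1`_0) H.
by rewrite !coefD !coefMX !coefC /= !addr0.
Qed.

(** The rigidity behind the theorem. First, [x] commutes with [x ^+ 2 = p ^+ 2],
    so [[p, x]] anticommutes with [p] and vanishes. Next, [[x y, x] = - x] and
    [x y = p q] give [p u = x] for [u = [x, q]]; bracketing this relation with
    [p] and with [q] shows that [u] is central, so that [x] is a multiple of
    [p]. *)
Lemma square_fixed_scalar x y :
  x * x = p * p -> x * y = p * q -> commutator x y = 1 ->
  exists2 c : K, c * c = 1 & x = c *: p /\ y = c *: q.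
Proof.
move=> xx xy cxy.
have px : commutator p x = 0.
  apply: anticommutes_p_eq0; rewrite /commutator mulrBr mulrBl !mulrA addrA subrK.
  by rewrite -xx -[_ * x * x]mulrA -[x * p * p]mulrA -!xx !mulrA subrr.
have pqx : commutator (p * q) x = - x.
  rewrite -xy commutatorMl commutatorxx mul0r addr0.
  by rewrite commutator_anti cxy mulrN1.
pose u := commutator x q.
have pu : p * u = x.
  by move: pqx; rewrite commutatorMl px mul0r addr0 commutator_anti mulrN => /oppr_inj.
have cpu : commutator p u = 0.
  apply: mulp_eq0; have := commutatorMr p p u.
  by rewrite pu px commutatorxx mul0r addr0.
have cuq : commutator u q = 0.
  apply: mulp_eq0; have := commutatorMl p u q.
  by rewrite pu comm_pq mul1r -/u => /esym/(canRL (addrK _)); rewrite subrr.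
have [c uc] := center_scalar cpu cuq.
have xc : x = c *: p by rewrite -pu uc -scalerAr mulr1.
have cc : c * c = 1.
  have /mulp_eq0/mulp_eq0 : p * (p * (c * c - 1)%:A) = 0.
    rewrite -!scalerAr mulr1 scalerBl scale1r -{2}xx xc -scalerAl -scalerAr scalerA.
    by rewrite subrr.
  by move/eqP; rewrite scaler_eq0 oner_eq0 orbF subr_eq0 => /eqP.
exists c => //; split=> //.
have <- : c *: y = q by apply: mulpI; rewrite -scalerAr -xy xc -scalerAl.
by rewrite scalerA cc scale1r.
Qed.
End NormalForm.

(** Words in [p] and [q] are put in normal form one letter at a time, since normal
    forms are stable under left multiplication by either generator. *)
Lemma weyl_normal_form (K : numFieldType) (a : weyl K) :
  exists F, a = normal_form (weyl_p K) (weyl_q K) F.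
Proof.
rewrite -[a]reprK pi_free_eval /free_eval mmapE.
elim/big_rec: _ => [|m b _ [F ->]].
  by exists 0; rewrite /normal_form raddf0 horner0.
have [G ->] : exists G, word_val (weyl_p K) (weyl_q K) m =
    normal_form (weyl_p K) (weyl_q K) G.
  rewrite /word_val; elim: (m : seq bool) => [|b' s [G]].
    by exists 1; rewrite big_nil normal_formC rmorph1.
  rewrite big_cons => ->; case: b'.
    by eexists; apply: mulp_normal_form; apply: weyl_pq.
  by exists ('X%:P * G); rewrite normal_formCM horner_algX.
by eexists; rewrite mulr_algl -normal_formZ -normal_formD.
Qed.

(** * Morphisms out of sl(2) and the adjoint action *)

Section SpecialLinear.
Variable K : numFieldType.
Implicit Types (g : SL2 K) (x y : sl2 K).

Lemma ord2_cases (P : 'I_2 -> Prop) : P 0 -> P 1 -> forall i, P i.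
Proof.
move=> P0 P1 [[|[|//]] ilt].
  by have -> : Ordinal ilt = 0 by apply: val_inj.
by have -> : Ordinal ilt = 1 by apply: val_inj.
Qed.

Lemma mulmx22E (a b : 'M[K]_2) i j : (a *m b) i j = a i 0 * b 0 j + a i 1 * b 1 j.
Proof.
rewrite mxE !big_ord_recl big_ord0 addr0; congr (_ + a _ _ * b _ _); exact: val_inj.
Qed.

Lemma sl2_basisE x :
  x = val x 0 1 *: e_plus K + val x 1 0 *: e_minus K
      + val x 0 0 *: lie (e_plus K) (e_minus K).
Proof.
apply: val_inj; rewrite /= /commutator; apply/matrixP.
apply: ord2_cases; apply: ord2_cases; rewrite !(mulmx22E, mxE) /=; try ring.
by have := sl2_11 x; rewrite /= => ->; ring.
Qed.

Lemma Ad_eq g x y : val g *m val x = val y *m val g -> Ad g x = y.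
Proof. by move=> gxy; apply: val_inj; rewrite /= gxy mulmxK ?SL2_unit. Qed.

(** [e_plus] and [e_minus] generate sl(2), [e_0] being their bracket. *)
Lemma sl2_lie_morphism_ext (L : lieAlgType K) (f1 f2 : sl2 K -> L) :
  lie_morphism f1 -> lie_morphism f2 ->
  f1 (e_plus K) = f2 (e_plus K) -> f1 (e_minus K) = f2 (e_minus K) -> f1 =1 f2.
Proof.
move=> [lin1 lie1] [lin2 lie2] fp fm x.
have add1 u v : f1 (u + v) = f1 u + f1 v by rewrite -[u]scale1r lin1 !scale1r.
have add2 u v : f2 (u + v) = f2 u + f2 v by rewrite -[u]scale1r lin2 !scale1r.
have f10 : f1 0 = 0 by apply: (addrI (f1 0)); rewrite -add1 !addr0.
have f20 : f2 0 = 0 by apply: (addrI (f2 0)); rewrite -add2 !addr0.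
have scale1 c u : f1 (c *: u) = c *: f1 u by rewrite -[c *: u]addr0 lin1 f10 addr0.
have scale2 c u : f2 (c *: u) = c *: f2 u by rewrite -[c *: u]addr0 lin2 f20 addr0.
rewrite (sl2_basisE x) !(add1, add2) !(scale1, scale2).
by rewrite lie1 lie2 fp fm.
Qed.

Definition mx22 (a b c d : K) : 'M[K]_2 :=
  \matrix_(i, j) if i == 0 then (if j == 0 then a else b)
                 else (if j == 0 then c else d).

Lemma mx22E (a b c d : K) :
  (mx22 a b c d 0 0 = a) * (mx22 a b c d 0 1 = b)
  * (mx22 a b c d 1 0 = c) * (mx22 a b c d 1 1 = d).
Proof. by rewrite !mxE. Qed.

Lemma SL2_detE g : val g 0 0 * val g 1 1 - val g 0 1 * val g 1 0 = 1.
Proof. by rewrite -det_mx22; apply/eqP/(valP g). Qed.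

Lemma invmx_SL2 g :
  invmx (val g) = mx22 (val g 1 1) (- val g 0 1) (- val g 1 0) (val g 0 0).
Proof.
apply: (can_inj (mulKmx (SL2_unit g))); rewrite mulmxV ?SL2_unit //.
apply/matrixP; apply: ord2_cases; apply: ord2_cases; rewrite mulmx22E !mx22E !mxE /=.
- by rewrite mulrN SL2_detE.
- by ring.
- by ring.
- by apply: etrans (esym (SL2_detE g)) _ => /=; ring.
Qed.

Lemma Ad_E g x i j : val (Ad g x) i j =
  (val g i 0 * val x 0 0 + val g i 1 * val x 1 0) * invmx (val g) 0 j
  + (val g i 0 * val x 0 1 + val g i 1 * val x 1 1) * invmx (val g) 1 j.
Proof. by rewrite [val _]/= !mulmx22E. Qed.

End SpecialLinear.

Lemma sqr_lincomb (K : comNzRingType) (A : algType K) (a b : K) (x y : A) :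
  (a *: x + b *: y) ^+ 2 =
  (a * a) *: x ^+ 2 + (b * b) *: y ^+ 2 + (a * b) *: (y * x + x * y).
Proof.
rewrite !expr2 mulrDl !mulrDr -!scalerAl -!scalerAr !scalerA.
rewrite scalerDr [b * a]mulrC.
by rewrite [LHS](AC (2*2) (1*4*(3*2))).
Qed.

Lemma half_sqr_lincomb (K : numFieldType) (A : algType K) (a b : K) (x y : A) :
  2^-1 *: (a *: x + b *: y) ^+ 2 =
  - (a * a) *: (- (2^-1 *: x ^+ 2)) + (b * b) *: (2^-1 *: y ^+ 2)
  + (a * b) *: (2^-1 *: (y * x + x * y)).
Proof.
rewrite sqr_lincomb !scalerDr scaleNr scalerN opprK !scalerA.
by congr (_ *: _ + _ *: _ + _); [exact: mulrC | exact: mulrC |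
  rewrite -!scalerDr; congr (_ *: _); exact: mulrC].
Qed.

Section Equivariance.
Variable K : numFieldType.

(** Under [fI], the Lie algebra is the space of quadratic forms in [p] and [q], on
    which [SL2] acts by linear substitution. As both sides are Lie morphisms in
    [x], it is enough to compare the squares of two linear forms. *)
Lemma alpha1_fI (g : SL2 K) (x : sl2 K) : alpha1 g (fI K x) = fI K (Ad g x).
Proof.
have lie_alpha : lie_morphism (fun x => alpha1 g (fI K x)).
  have [lin lie] := sl2_emb_lie_morphism (fI K); split=> [c y z|y z].
    by rewrite lin linearP.
  by rewrite lie; apply: (rmorph_commutator (alpha1 g)).
have lie_Ad : lie_morphism (fun x => fI K (Ad g x)).
  have [lin lie] := sl2_emb_lie_morphism (fI K); split=> [c y z|y z].
    by rewrite linearP lin.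
  by rewrite lie_aut_lie lie.
apply: (sl2_lie_morphism_ext lie_alpha lie_Ad) => /=.
  rewrite fI_e_plus linearN linearZ rmorphXn /= alpha1_qE half_sqr_lincomb.
  rewrite [RHS]/(fI_fun _) /fI_fun !Ad_E invmx_SL2 !mx22E !mxE /=.
  move: (- (2^-1 *: weyl_q K ^+ 2)) (2^-1 *: weyl_p K ^+ 2) => e f.
  rewrite !opprD -!scaleNr; apply: lin3_congr; ring.
rewrite fI_e_minus linearZ rmorphXn /= alpha1_pE half_sqr_lincomb.
rewrite [RHS]/(fI_fun _) /fI_fun !Ad_E invmx_SL2 !mx22E !mxE /=.
by apply: lin3_congr; ring.
Qed.

End Equivariance.

(** * Automorphisms of sl(2) are inner *)

Lemma val_sl2Z (K : fieldType) (c : K) (x : sl2 K) i j :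
  val (c *: x) i j = c * val x i j.
Proof. by rewrite [val _]/= mxE. Qed.

(** An eigenvector [x] of [ad h] of nonzero eigenvalue is nilpotent: [c tr(x ^+ 2)]
    is the trace of [[h, x] x], which is zero. For a traceless [x], [tr(x ^+ 2) = 0]
    is the vanishing of the determinant of [x]. *)
Lemma sl2_nilpotent_coef (K : numFieldType) (h x : sl2 K) (c : K) :
  c != 0 -> lie h x = c *: x -> val x 0 1 * - val x 1 0 = val x 0 0 * val x 0 0.
Proof.
move=> c0 hx.
have E i j : c * val x i j = val (lie h x) i j by rewrite hx val_sl2Z.
have := E 0 0; have := E 0 1; have := E 1 0; rewrite !sl2_lieE !sl2_11.
move: (val x 0 0) (val x 0 1) (val x 1 0) (val h 0 0) (val h 0 1) (val h 1 0).
move=> x00 x01 x10 h00 h01 h10 E10 E01 E00.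
have c2 : 2 * c != 0 by rewrite mulf_neq0 ?pnatr_eq0.
apply: (mulfI c2).
have -> : 2 * c * (x01 * - x10) = - ((c * x01) * x10 + x01 * (c * x10)) by ring.
have -> : 2 * c * (x00 * x00) = 2 * x00 * (c * x00) by ring.
by rewrite E10 E01 E00; ring.
Qed.

(** A quadratic form of zero discriminant over an algebraically closed field is
    the square of a linear form. *)
Lemma sqrtC_mul (K : numClosedFieldType) (a b c : K) : a * b = c * c ->
  exists s t, [/\ s * s = a, t * t = b & s * t = c].
Proof.
move=> abc; pose s := sqrtC a; pose t := sqrtC b.
have ss : s * s = a by rewrite -expr2 sqrtCK.
have tt : t * t = b by rewrite -expr2 sqrtCK.
have /eqP : (s * t) ^+ 2 = c ^+ 2 by rewrite !expr2 mulrACA ss tt.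
rewrite eqf_sqr => /orP[/eqP st|/eqP st]; first by exists s, t.
by exists s, (- t); rewrite mulrNN mulrN st opprK.
Qed.

Lemma lie_e_0_e_plus (K : numFieldType) :
  lie (lie (e_plus K) (e_minus K)) (e_plus K) = 2 *: e_plus K.
Proof.
apply: val_inj; apply/matrixP.
by apply: ord2_cases; apply: ord2_cases;
  rewrite val_sl2Z !sl2_lieE /= !mxE /=; ring.
Qed.

Lemma lie_e_0_e_minus (K : numFieldType) :
  lie (lie (e_plus K) (e_minus K)) (e_minus K) = - 2 *: e_minus K.
Proof.
apply: val_inj; apply/matrixP.
by apply: ord2_cases; apply: ord2_cases;
  rewrite val_sl2Z !sl2_lieE /= !mxE /=; ring.
Qed.

(** The images of [e_minus] and [e_plus] are nilpotent of rank one. Writing their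
    quadratic forms as squares of linear forms, up to scalars, gives the columns of
    the matrix [g]; the brackets of sl(2) normalize its determinant. *)
Lemma lie_aut_sl2_inner (K : numClosedFieldType) (w : lie_aut (sl2 K)) :
  exists g, w = Ad g.
Proof.
pose x := w (e_minus K); pose y := w (e_plus K).
have hy : lie (lie y x) y = 2 *: y.
  by rewrite -!lie_aut_lie lie_e_0_e_plus linearZ.
have hx : lie (lie y x) x = - 2 *: x.
  by rewrite -!lie_aut_lie lie_e_0_e_minus linearZ.
(* As x is nilpotent of rank one, the quadratic form attached to x is, up to
   a scalar, the square of the linear form of coefficients t and s; likewise
   u and v for y. *)
have [t [s [tt ss ts]]] : exists t s : K,
    [/\ t * t = - val x 0 1, s * s = val x 1 0 & t * s = val x 0 0].
  apply: sqrtC_mul; rewrite mulNr -mulrN; apply: sl2_nilpotent_coef hx.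
  by rewrite oppr_eq0 pnatr_eq0.
have [u [v [uu vv uv]]] : exists u v : K,
    [/\ u * u = val y 0 1, v * v = - val y 1 0 & u * v = - val y 0 0].
  apply: sqrtC_mul; rewrite mulrNN; apply: sl2_nilpotent_coef hy.
  by rewrite pnatr_eq0.
have x01 : val x 0 1 = - (t * t) by rewrite tt opprK.
have y00 : val y 0 0 = - (u * v) by rewrite uv opprK.
have y10 : val y 1 0 = - (v * v) by rewrite vv opprK.
pose d := u * s - t * v.
(* Since y is nilpotent of rank one, hy reads 2 y x y = 2 tr(xy) y = 2 y, and
   tr(xy) is d ^+ 2. *)
have dd : d * d = 1.
  have E i j : 2 * val y i j = val (lie (lie y x) y) i j by rewrite hy val_sl2Z.
  have u0 : (d * d - 1) * (u * u) = 0.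
    have := E 0 1; rewrite !sl2_lieE !sl2_11 x01 y00 y10 -uu -ss -ts => E01.
    have n2 : 2 != 0 :> K by rewrite pnatr_eq0.
    apply: (mulfI n2); rewrite mulr0.
    by move/esym/eqP: E01; rewrite -subr_eq0 => /eqP <-; rewrite /d; ring.
  have v0 : (d * d - 1) * (v * v) = 0.
    have := E 1 0; rewrite !sl2_lieE !sl2_11 x01 y00 y10 -uu -ss -ts => E10.
    have n2 : 2 != 0 :> K by rewrite pnatr_eq0.
    apply: (mulfI n2); rewrite mulr0.
    by move/eqP: E10; rewrite -subr_eq0 => /eqP <-; rewrite /d; ring.
  apply/eqP; rewrite -subr_eq0; apply/eqP.
  move/eqP: u0; rewrite mulf_eq0 => /orP[/eqP //|]; rewrite mulf_eq0 orbb => /eqP u0.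
  move/eqP: v0; rewrite mulf_eq0 => /orP[/eqP //|]; rewrite mulf_eq0 orbb => /eqP v0.
  have y0 : y = 0.
    rewrite (sl2_basisE y) -uu y10 y00 u0 v0 !mulr0 !oppr0 !scale0r !addr0 //.
  have /(congr1 (fun z : sl2 K => val z 0 1)) : e_plus K = 0.
    apply: (bij_inj (bijection_bij (val w))).
    by rewrite -[LHS]/y y0; exact/esym/(raddf0 w).
  by rewrite /= !mxE /= => /eqP; rewrite oner_eq0.
(* Replacing (u, v) by (d u, d v) changes no product u u, v v, u v and makes d equal to 1. *)
have gP : \det (mx22 (d * u) t (d * v) s) == 1.
  by rewrite det_mx22 !mx22E -dd /d; apply/eqP; ring.
exists (mk_SL2 gP).
apply: lie_autP.
have wL : lie_morphism w by split; [exact: linearP | exact: lie_aut_lie].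
have AdL : lie_morphism (Ad (mk_SL2 gP)).
  by split; [exact: linearP | exact: lie_aut_lie].
apply: (sl2_lie_morphism_ext wL AdL); apply/esym/Ad_eq;
  rewrite [val _]/= -?/x -?/y; apply/matrixP; apply: ord2_cases; apply: ord2_cases;
  rewrite !mulmx22E ?sl2_11 ?y00 ?y10 -?uu ?x01 -?ss -?ts !mx22E !mxE /=;
  try by rewrite /d; ring.
  by rewrite mulr0 add0r mulr1 -[LHS]mulr1 -dd /d; ring.
by rewrite mulr0 add0r mulr1 -[LHS]mulr1 -dd /d; ring.
Qed.

(** * The stabilizer *)

Lemma isotropyP (K : fieldType) (f : sl2_emb K) (c : aut_group K) :
  isotropy f c <-> forall x, c.1 (f x) = f (c.2 x).
Proof.
split=> [cf x|cf]; last first.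
  apply: sl2_embP => x; rewrite /= /sl2_emb_fun /= /emb_act_fun cf.
  by congr (f _); apply: (bijection_Kinv (val c.2)).
rewrite -{2}cf /= {2}/sl2_emb_fun /= /emb_act_fun; congr (c.1 (f _)).
by apply/esym/(bijection_invK (val c.2)).
Qed.

Section Stabilizer.
Variable K : numClosedFieldType.
Local Notation p := (weyl_p K).
Local Notation q := (weyl_q K).

(** [b] fixes [p ^+ 2] and [p q + q p]; as it also fixes [p q - q p = 1], it fixes
    [p q]. *)
Lemma fixes_fI_scalar (b : alg_aut (weyl K)) : (forall x, b (fI K x) = fI K x) ->
  exists2 c : K, c * c = 1 & b p = c *: p /\ b q = c *: q.
Proof.
move=> bfI.
have n2 : 2^-1 != 0 :> K by rewrite invr_eq0 pnatr_eq0.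
have pp : b p * b p = p * p.
  apply: (scalerI n2); rewrite -!rmorphM -linearZ -!expr2 /=.
  by rewrite -fI_e_minus bfI.
have cpq : commutator (b p) (b q) = 1.
  by rewrite -rmorph_commutator [commutator _ _]weyl_pq rmorph1.
have sym : b p * b q + b q * b p = p * q + q * p.
  apply: (scalerI n2); rewrite -!rmorphM -rmorphD -linearZ /=.
  by rewrite -fI_e_0 bfI.
have half (r t : weyl K) : commutator r t = 1 -> r * t = 2^-1 *: (r * t + t * r + 1).
  move=> <-; apply/(@scalerI _ _ (2 : K)); first by rewrite pnatr_eq0.
  rewrite scalerA divff ?pnatr_eq0 // scale1r scaler_nat mulr2n /commutator.
  by rewrite addrACA subrr addr0.
apply: (square_fixed_scalar (weyl_pq K) (@weyl_normal_form K)) => //.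
by rewrite (half _ _ cpq) sym -half //; exact: weyl_pq.
Qed.

Lemma SL2_scalar_subproof (c : K) : c * c = 1 -> \det (c%:M : 'M[K]_2) == 1.
Proof. by rewrite det_scalar expr2 => ->. Qed.

Definition SL2_scalar (c : K) (cc : c * c = 1) : SL2 K :=
  mk_SL2 (SL2_scalar_subproof cc).

Lemma Ad_scalar (c : K) (cc : c * c = 1) : Ad (SL2_scalar cc) = 1%g.
Proof.
apply: lie_autP => x; apply: Ad_eq.
by rewrite /= mul_scalar_mx mul_mx_scalar.
Qed.

Lemma alg_aut_weyl_ext (a b : alg_aut (weyl K)) : a p = b p -> a q = b q -> a = b.
Proof. by move=> ap aq; apply: alg_autP; apply: (@weyl_ext K (weyl K) a b). Qed.

Lemma alpha1_1 : alpha1 (1%g : SL2 K) = 1%g.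
Proof. by apply: alg_autP => z; apply: alpha1_fun1. Qed.

(** Dividing [(a, w)] by [(alpha1 g, Ad g)], where [w = Ad g], leaves an
    automorphism fixing [fI] pointwise, that is [alpha1] of the scalar matrix
    [s = 1] or [s = -1]. This scalar is absorbed into [g] because [Ad] does not
    see it. *)
Lemma isotropy_fI (c : aut_group K) :
  isotropy (fI K) c <-> exists g, c = (alpha1 g, Ad g).
Proof.
split=> [/isotropyP|[g ->]]; last by apply/isotropyP => x; apply: alpha1_fI.
case: c => a w /= aw.
have [g wg] := lie_aut_sl2_inner w.
pose b := (alpha1 g^-1 * a)%g.
have [x|s ss [bp bq]] := fixes_fI_scalar (b := b).
  change (alpha1 (g^-1)%g (a (fI K x)) = fI K x).
  by rewrite aw wg alpha1_fI; congr (fI K _); rewrite -[LHS]Ad_funM mulVg Ad_fun1.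
have bE : b = alpha1 (SL2_scalar ss).
  apply: alg_aut_weyl_ext; first by rewrite bp alpha1_pE /= !mxE /= scale0r add0r.
  by rewrite bq alpha1_qE /= !mxE /= scale0r addr0.
exists (g * SL2_scalar ss)%g; congr pair.
  by rewrite alpha1M -bE /b mulgA -alpha1M mulgV alpha1_1 mul1g.
by rewrite AdM Ad_scalar mulg1.
Qed.

Lemma alpha1_inj : injective (@alpha1 K).
Proof.
move=> g h gh; apply: val_inj; apply/matrixP.
have /(pq_free (weyl_pq K)) [g01 g11] :
    val g 0 1 *: q + val g 1 1 *: p = val h 0 1 *: q + val h 1 1 *: p.
  by move: (alpha1_pE g); rewrite gh => <-; apply: alpha1_pE.
have /(pq_free (weyl_pq K)) [g00 g10] :
    val g 0 0 *: q + val g 1 0 *: p = val h 0 0 *: q + val h 1 0 *: p.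
  by move: (alpha1_qE g); rewrite gh => <-; apply: alpha1_qE.
by apply: ord2_cases; apply: ord2_cases.
Qed.

End Stabilizer.

Theorem proposition6p8 (R : realType) :
  (isotropy (fI R[i]) = [set (alpha1 g, Ad g) | g in [set: SL2 R[i]]])%classic /\
  (exists phi : {multiplicative SL2 R[i] -> isotropy_group (fI R[i])},
     bijective phi).
Proof.
split.
  apply/seteqP; split=> c; first by move=> /isotropy_fI[g ->]; exists g.
  by move=> [g _ <-]; apply/isotropy_fI; exists g.
have in_iso g : (alpha1 g, Ad g) \in isotropy (fI R[i]).
  by rewrite inE; apply/isotropy_fI; exists g.
pose phi g : isotropy_group (fI R[i]) := exist _ (alpha1 g, Ad g) (in_iso g).
have phiM : {morph phi : g h / (g * h)%g}.
  by move=> g h; apply: val_inj; congr pair; rewrite gmulfM.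
pose phi_mul := monoid.isMultiplicative.Build _ _ phi phiM.
pose phi_morph : {multiplicative SL2 R[i] -> isotropy_group (fI R[i])} :=
  HB.pack phi phi_mul.
have phi_onto c : exists g, phi g = c.
  have := valP c; rewrite inE => /isotropy_fI[g cg].
  by exists g; apply: val_inj; rewrite cg.
have phi_inj : injective phi.
  move=> g h gh; apply: alpha1_inj.
  exact: (congr1 (fun c : isotropy_group (fI R[i]) => (val c).1) gh).
have phi_bij : bijective phi.
  exists (fun c => xget 1%g [set g | phi g = c]%classic) => [g|c].
    by case: xgetP => [h _ /phi_inj|/(_ g)/(_ (erefl _))].
  by have [g gc] := phi_onto c; case: xgetP => [h _|/(_ g)].
by exists phi_morph.
Qed.
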